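(* Let $R$ be a (not-necessarily-commutative) ring, and let $A=(a_{ij})$ and $B=(b_{ij})$ be $m\times n$ matrices with elements in $R$. Suppose that for all $i,k\in[m]$ and $j,l\in[n]$ $$[a_{ij},b_{kl}] = -\delta_{ik}h_{jl},$$ where $(h_{jl})_{j,l=1}^n$ are elements of $R$. Then, for any $I,J\subseteq[n]$ of cardinality $|I|=|J|=r$ (with $1\le r\le n$; $r>m$ is allowed), writing $I=\{i_1<\dots<i_r\}$ and $J=\{j_1<\dots<j_r\}$: (a) If $A$ is column-pseudo-commutative, then $$\sum_{L\subseteq[m],\,|L|=r}\bigl(\text{col-det}\,(A^{\mathrm T})_{IL}\bigr)\bigl(\text{col-det}\,B_{LJ}\bigr)=\text{col-det}\bigl[(A^{\mathrm T}B)_{IJ}+Q_{\rm col}\bigr],$$ where $(Q_{\rm col})_{\alpha\beta}=(r-\beta)\,h_{i_\alpha j_\beta}$ for $1\le\alpha,\beta\le r$. (b) If $B$ is column-pseudo-commutative, then $$\sum_{L\subseteq[m],\,|L|=r}\bigl(\text{row-det}\,(A^{\mathrm T})_{IL}\bigr)\bigl(\text{row-det}\,B_{LJ}\bigr)=\text{row-det}\bigl[(A^{\mathrm T}B)_{IJ}+Q_{\rm row}\bigr],$$ where $(Q_{\rm row})_{\alpha\beta}=(\alpha-1)\,h_{i_\alpha j_\beta}$ for $1\le\alpha,\beta\le r$. In particular, (c) If $[a_{ij},a_{kl}]=0$ and $[b_{ij},b_{kl}]=0$ whenever $j\ne l$, then $$\sum_{L\subseteq[m],\,|L|=r}\bigl(\det\,(A^{\mathrm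 T})_{IL}\bigr)\bigl(\det B_{LJ}\bigr)=\text{col-det}\bigl[(A^{\mathrm T}B)_{IJ}+Q_{\rm col}\bigr]=\text{row-det}\bigl[(A^{\mathrm T}B)_{IJ}+Q_{\rm row}\bigr].$$
   Context: Notation: $[n]=\{1,\dots,n\}$; $[x,y]=xy-yx$; $M_{IJ}$ is the submatrix of $M$ with rows $I$ and columns $J$ kept in their original (increasing) order; empty sums are $0$. $\delta_{ik}h_{jl}$ means $h_{jl}$ if $i=k$ and $0$ otherwise (so $R$ need not have an identity). For an $r\times r$ matrix $M$ over a ring, $\text{col-det}\,M=\sum_{\sigma\in\mathcal S_r}\mathrm{sgn}(\sigma)\,M_{\sigma(1)1}M_{\sigma(2)2}\cdots M_{\sigma(r)r}$ and $\text{row-det}\,M=\sum_{\sigma\in\mathcal S_r}\mathrm{sgn}(\sigma)\,M_{1\sigma(1)}M_{2\sigma(2)}\cdots M_{r\sigma(r)}$. When entries not in the same row and not in the same column commute, the two coincide and are written $\det M$; this applies to the determinants written $\det$ in (c). A (not necessarily square) matrix $M$ is column-pseudo-commutative if $[M_{ij},M_{kl}]=[M_{il},M_{kj}]$ for all $i,j,k,l$ and $[M_{ij},M_{il}]=0$ for all $i,j,l$. *)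

(* Defs.v *)
From HB Require Import structures.
From mathcomp Require Import all_boot all_order all_fingroup all_algebra.

Set Implicit Arguments.
Unset Strict Implicit.
Unset Printing Implicit Defensive.

Import GRing.Theory.
Local Open Scope ring_scope.

(* MathComp's ring structures are all unital.  A ring that need not have an
   identity is a Z-module which is also a semigroup, whose product (written
   [(x * y)%g]) distributes over addition.  No commutativity is assumed. *)
HB.mixin Record isRng R of GRing.Zmodule R & Semigroup R := {
  rng_mulDl : left_distributive (@monoid.mul R) +%R;
  rng_mulDr : right_distributive (@monoid.mul R) +%R
}.

#[short(type="rngType")]
HB.structure Definition Rng := {R of isRng R & GRing.Zmodule R & Semigroup R}.

(* Unital rings are an instance, through an alias of the carrier. *)
Definition rng_of (R : Type) : Type := R.
HB.instance Definition _ (R : pzRingType) := GRing.Zmodule.on (rng_of R).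
HB.instance Definition _ (R : pzRingType) :=
  hasMul.Build (rng_of R) (@GRing.mul R).
HB.instance Definition _ (R : pzRingType) :=
  Magma_isSemigroup.Build (rng_of R) (@mulrA R).
HB.instance Definition _ (R : pzRingType) :=
  isRng.Build (rng_of R) (@mulrDl R) (@mulrDr R).

Definition bracket (R : rngType) (x y : R) : R := (x * y)%g - (y * x)%g.

(* [mulmx] needs a unital (semi)ring of coefficients. *)
Definition rng_mulmx (R : rngType) m n p (A : 'M[R]_(m, n)) (B : 'M[R]_(n, p)) :
    'M[R]_(m, p) :=
  \matrix_(i, k) \sum_j (A i j * B j k)%g.

(* The product x_1 x_2 ... x_r, in this order, of a nonempty sequence.  With no
   identity there is no empty product: [mulseq [::]] is a dummy value, so the
   determinants below are only meaningful for matrices of size r >= 1. *)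
Definition mulseq (R : rngType) (s : seq R) : R :=
  if s is x :: s' then foldl (@monoid.mul R) x s' else 0.

Definition col_det (R : rngType) r (M : 'M[R]_r) : R :=
  \sum_(s : 'S_r) mulseq [seq M (s j) j | j <- enum 'I_r] *~ (-1) ^+ s.

Definition row_det (R : rngType) r (M : 'M[R]_r) : R :=
  \sum_(s : 'S_r) mulseq [seq M i (s i) | i <- enum 'I_r] *~ (-1) ^+ s.

(* Only used for matrices whose entries lying neither in the same row nor in
   the same column commute; by [row_det_comm] below, the choice of [col_det]
   rather than [row_det] is then immaterial. *)
Definition rng_det (R : rngType) r (M : 'M[R]_r) : R := col_det M.

Definition col_pseudo_comm (R : rngType) m n (M : 'M[R]_(m, n)) : Prop :=
  (forall i j k l, bracket (M i j) (M k l) = bracket (M i l) (M k j)) /\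
  (forall i j l, bracket (M i j) (M i l) = 0).

Definition rsubset (n r : nat) := {I : {set 'I_n} | #|I| == r}.

(* For I = {i_0 < ... < i_(r-1)}, [elt I a] is i_a; see [elt_lt] and [mem_elt]. *)
Definition elt n r (I : rsubset n r) (a : 'I_r) : 'I_n :=
  enum_val (cast_ord (esym (eqP (valP I))) a).

Definition minormx (T : Type) m n r (M : 'M[T]_(m, n))
    (I : rsubset m r) (J : rsubset n r) : 'M[T]_r :=
  mxsub (elt I) (elt J) M.

(* Indices a, b start at 0 instead of 1, whence r - (b + 1) for r - beta and
   a for alpha - 1. *)
Definition Qcol (R : rngType) n r (h : 'M[R]_n) (I J : rsubset n r) : 'M[R]_r :=
  \matrix_(a, b) (h (elt I a) (elt J b) *+ (r - b.+1)).

Definition Qrow (R : rngType) n r (h : 'M[R]_n) (I J : rsubset n r) : 'M[R]_r :=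
  \matrix_(a, b) (h (elt I a) (elt J b) *+ a).

Lemma mem_elt n r (I : rsubset n r) a : elt I a \in val I.
Proof. exact: enum_valP. Qed.

Lemma elt_lt n r (I : rsubset n r) (a b : 'I_r) :
  (a < b)%N -> (elt I a < elt I b)%N.
Proof.
move=> ltab; pose x0 := elt I a.
rewrite /elt !(enum_val_nth x0) /=.
have sz : size (enum (val I)) = r by rewrite -cardE (eqP (valP I)).
have srt : sorted (fun x y : 'I_n => x < y)%N (enum (val I)).
  rewrite /(enum _) -enumT; apply: sorted_filter => [? ? ?|].
    exact: ltn_trans.
  by have := iota_ltn_sorted 0 n; rewrite -val_enum_ord sorted_map.
apply: (sorted_ltn_nth _ x0 srt); rewrite ?inE ?sz //.
by move=> ? ? ?; apply: ltn_trans.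
Qed.

Lemma mulseq_cons (R : rngType) (x : R) s :
  s != [::] -> mulseq (x :: s) = (x * mulseq s)%g.
Proof.
case: s => // y s _ /=; elim: s y => //= z s IH y.
by rewrite -mulgA IH.
Qed.

Lemma mulseq_cat (R : rngType) (s t : seq R) :
  s != [::] -> t != [::] -> mulseq (s ++ t) = (mulseq s * mulseq t)%g.
Proof.
move=> s0 t0; elim: s s0 => // x [|y s] IH _; first exact: mulseq_cons.
by rewrite cat_cons mulseq_cons // IH // mulgA -(mulseq_cons x).
Qed.

Lemma mulseq_perm (R : rngType) (T : eqType) (f : T -> R) (s t : seq T) :
    (forall x y, commute (f x) (f y)) -> perm_eq s t ->
  mulseq (map f s) = mulseq (map f t).
Proof.
move=> fC; pose F u := mulseq (map f u).
have C1 x u : u != [::] -> commute (f x) (mulseq (map f u)).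
  elim: u => // y [|z u] IH _; first exact: fC.
  by rewrite map_cons mulseq_cons // /commute mulgA fC -mulgA IH // mulgA.
have C u v : u != [::] -> v != [::] ->
    commute (mulseq (map f u)) (mulseq (map f v)).
  move=> + v0; elim: u => // y [|z u] IH _; first exact: C1.
  by rewrite map_cons mulseq_cons // /commute -mulgA IH // !mulgA C1.
apply: (@catCA_perm_subst _ _ F) => [[|x u] [|y v] w] //; rewrite /F.
have E : mulseq (map f ((x :: u) ++ (y :: v))) =
         mulseq (map f ((y :: v) ++ (x :: u))).
  by rewrite !map_cat !mulseq_cat // C.
rewrite !catA; case: w => [|z w]; first by rewrite !cats0.
by rewrite !(map_cat f (_ ++ _)) !(mulseq_cat (s := map f (_ ++ _))) // E.
Qed.

Lemma row_det_comm (R : rngType) r (M : 'M[R]_r) :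
    (forall i j k l, i != k -> j != l -> commute (M i j) (M k l)) ->
  row_det M = col_det M.
Proof.
move=> MC; rewrite /col_det (reindex_inj invg_inj) /=.
apply: eq_bigr => s _; rewrite odd_permV; congr (_ *~ _).
transitivity (mulseq [seq M i (s i) | i <- map (s^-1)%g (enum 'I_r)]).
  apply: mulseq_perm => [i k|].
    case: (eqVneq i k) => [-> //|ik].
    by apply: MC; rewrite // (inj_eq perm_inj).
  apply: uniq_perm; rewrite ?(map_inj_uniq perm_inj) ?enum_uniq // => i.
  rewrite mem_enum; apply/esym/mapP; exists (s i); first by rewrite mem_enum.
  by rewrite permK.
by rewrite -map_comp; congr mulseq; apply: eq_map => j /=; rewrite permKV.
Qed.

(* Main.v *)
Require Import Defs.
From HB Require Import structures.
From mathcomp Require Import all_boot all_order all_fingroup all_algebra.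

Set Implicit Arguments.
Unset Strict Implicit.
Unset Printing Implicit Defensive.

(** Write the noncommutative determinant as a coefficient in a Grassmann
    algebra.  Let S be a unital ring and let E_1, ..., E_r be pairwise
    anticommuting elements of square zero which commute with S.  Expanding the
    product of the column forms sum_p M_pq E_p, for q = 1, ..., r in this order,
    gives (col-det M) E_1 ... E_r for every matrix M over S, and scalars can be
    read off from their multiples of E_1 ... E_r ([prod_form],
    [scalar_top_form_inj]).

    Put A_f = sum_p a_(f, i_p) E_p for each row index f of A, and
    H_q = sum_p h_(i_p, j_q) E_p.  If A is column-pseudo-commutative, then
    A_f A_g + A_g A_f and H_q A_f + A_f H_q have coefficients symmetric in the
    indices of the E's, hence vanish, and so does the square of A_f
    ([symmetric_form0]).  The hypothesis on the brackets becomes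
    A_f b_(g, q) = b_(g, q) A_f - delta_(f, g) H_q.  On the left of the identity,
    the products A_(f 1) ... A_(f r) are alternating in f
    ([alternating_perm], [alternating_repeat]), so the sum over r-subsets L and
    over the permutations in col-det B_(L J) is a sum over all maps f from [r]
    to [m] of A_(f 1) ... A_(f r) b_(f 1, 1) ... b_(f r, r).  On the right stands
    the product over q of sum_f A_f b_(f, q) + (r - q) H_q.

    The two agree because the b's can be moved left, one at a time.  Moving
    b_(f 1, 1) across A_(f 2) ... A_(f r) produces, at each of the r - 1
    positions k with f k = f 1, one term where H_1 stands in place of A_(f k).
    Anticommuting H_1 to the far left and A_(f 1) back to position k gives each
    of these terms the same sign, and their sum is (r - 1) H_1 times
    A_(f 2) ... A_(f r): this is the origin of the correction Q
    ([capelli_contraction], [capelli_rearrangement]).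

    Part (b) is part (a) in the opposite ring, with A and B exchanged and the
    order of the indices 1, ..., r reversed ([rowdet_converse]).  Under the
    hypothesis of (c) both A and B are column-pseudo-commutative and the row and
    column determinants of the minors on the left agree, so (a) and (b) have the
    same left-hand side.

    The Grassmann algebra is realized by the creation operators of fermionic
    Fock space, as matrices whose rows and columns are indexed by the subsets of
    [r].  Rings without identity are handled by embedding R into Z + R. *)

Import GRing.Theory.
Local Open Scope ring_scope.

(** * Alternating products of anticommuting elements *)

(** In a noncommutative ring the order of the factors matters; this makes it
    explicit and allows the product to be cut into pieces. *)
Lemma prod_enum (S : pzRingType) (T : finType) (F : T -> S) :
  \prod_i F i = \prod_(i <- enum T) F i.
Proof. by rewrite enumT unlock. Qed.

(** The product over [T] is to be compared with itself after exchanging the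
    factors at [p] and [q].  Which of the two comes first in the enumeration is
    irrelevant for a transposition, whence the renaming to [u] and [v]. *)
Lemma enum_split_pair (T : finType) (p q : T) : p != q ->
  exists u v (s1 s2 s3 : seq T),
    [/\ enum T = s1 ++ u :: s2 ++ v :: s3, tperm p q = tperm u v
      & forall i, i \in s1 ++ s2 ++ s3 -> (u != i) && (v != i)].
Proof.
move=> pq; have split3 (t1 t2 t3 : seq T) u v : uniq (t1 ++ u :: t2 ++ v :: t3) ->
    forall i, i \in t1 ++ t2 ++ t3 -> (u != i) && (v != i).
  rewrite (perm_uniq (s2 := u :: v :: t1 ++ t2 ++ t3)); last first.
    rewrite -[u :: _ ++ _]cat1s perm_catCA /= perm_cons catA.
    by rewrite -[v :: t3]cat1s perm_catCA /= perm_cons catA.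
  rewrite /= inE negb_or => /and3P[/andP[_ ut] vt _] i it.
  by rewrite !(contraTneq _ it) // => <-.
have := enum_uniq T; have: q \in enum T by rewrite mem_enum.
have: p \in enum T by rewrite mem_enum.
move: (enum T) => s /splitPr[s1 s2]; rewrite mem_cat inE eq_sym (negPf pq) /=.
case/orP => /splitPr[t1 t2] U.
  exists q, p, t1, t2, s2; rewrite -catA in U *.
  by split=> //; [exact: tpermC | exact: split3].
by exists p, q, s1, t1, t2; split=> //; exact: split3.
Qed.

Section Anticommutation.
Variable Lam : pzRingType.

Lemma anticomm_prod (I : Type) (x : I -> Lam) (y : Lam) (s : seq I) :
    (forall i, y * x i = - (x i * y)) ->
  y * \prod_(i <- s) x i = (-1) ^+ size s * (\prod_(i <- s) x i * y).
Proof.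
move=> yx; elim: s => [|i s IH]; first by rewrite !big_nil mulr1 !mul1r.
rewrite !big_cons mulrA yx mulNr -mulrA IH /= exprS mulN1r mulNr; congr (- _).
by rewrite !mulrA (commr_sign (x i)).
Qed.

Variables (I : Type) (x : I -> Lam).
Hypothesis x_sq : forall u, x u * x u = 0.
Hypothesis x_anti : forall u v, x u * x v = - (x v * x u).

(** Up to the common sign (-1)^|s|, the two sides are the product over [s]
    followed by [x u * x v], respectively by [- (x v * x u)]. *)
Lemma anticomm_swap (u v : I) (s : seq I) :
  x u * (\prod_(i <- s) x i * x v) = - (x v * (\prod_(i <- s) x i * x u)).
Proof.
rewrite !mulrA !anticomm_prod // -!mulrA x_anti.
by rewrite !mulrN.
Qed.

Lemma alternating_tperm (T : finType) (f : T -> I) (p q : T) : p != q ->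
  \prod_k x (f (tperm p q k)) = - \prod_k x (f k).
Proof.
move=> pq; rewrite !prod_enum.
have [u [v [s1 [s2 [s3 [-> -> fixed]]]]]] := enum_split_pair pq.
rewrite !(big_cat, big_cons) /= tpermL tpermR.
have fixE s : {subset s <= s1 ++ s2 ++ s3} ->
    \prod_(i <- s) x (f (tperm u v i)) = \prod_(i <- s) x (f i).
  move=> ss; apply: eq_big_seq => i /ss/fixed/andP[ui vi]; by rewrite tpermD.
rewrite !fixE; try by move=> i; rewrite !mem_cat => ->; rewrite ?orbT.
have := anticomm_swap (f v) (f u) (map f s2).
rewrite big_map !mulrA => E; rewrite -mulNr; congr (_ * _).
by rewrite -!(mulrA (\prod_(j <- s1) _)) -mulrN E.
Qed.

Lemma alternating_perm (T : finType) (f : T -> I) (s : {perm T}) :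
  \prod_k x (f (s k)) = (-1) ^+ s * \prod_k x (f k).
Proof.
have [ts -> dts] := prod_tpermP s.
elim: ts dts f => [_ f|t ts IH /andP[dt dts] f] /=.
  by rewrite big_nil odd_perm1 mul1r; apply: eq_bigr => k _; rewrite perm1.
have t12 : t.1 != t.2 := dt.
rewrite big_cons odd_permM odd_tperm t12 signr_addb -mulrA -IH // mulN1r.
rewrite -(alternating_tperm (f \o _) dt).
by apply: eq_bigr => k _; rewrite permM.
Qed.

(** Anticommuting one of the two equal factors across the factors in between
    makes a square appear. *)
Lemma alternating_repeat (T : finType) (f : T -> I) (p q : T) :
  p != q -> f p = f q -> \prod_k x (f k) = 0.
Proof.
move=> pq fpq; have fuv u v : tperm p q = tperm u v -> f u = f v.
  move=> E; have : tperm p q u = v by rewrite E tpermL.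
  by case: tpermP => [-> | -> | _ _] <-.
rewrite prod_enum.
have [u [v [s1 [s2 [s3 [-> /fuv E _]]]]]] := enum_split_pair pq.
rewrite !(big_cat, big_cons) /= E (mulrA (\prod_(j <- s2) _)).
rewrite -(big_map f xpredT) (mulrA (x _)) (mulrA (x _)) anticomm_prod //.
by rewrite -!mulrA (mulrA (x (f v)) (x (f v))) x_sq !(mul0r, mulr0).
Qed.

End Anticommutation.

(** * The Grassmann algebra on Fock space *)
Section Fock.
Variables (S : pzRingType) (r : nat).
Local Notation N := #|{set 'I_r}|.

(** The basis vector attached to a set of occupied states. *)
Definition ket (T : {set 'I_r}) : 'rV[S]_N := delta_mx 0 (enum_rank T).

(** Acting on row vectors from the right.  The sign counts the elements of [T]
    above [p] (and not below), so that creating the states in increasing order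
    starting from the empty set involves no sign at all. *)
Definition creation (p : 'I_r) : 'M[S]_N :=
  \matrix_(i < N) let T : {set 'I_r} := enum_val i in
    if p \in T then 0 else (-1) ^+ #|[set q in T | (p < q)%N]| *: ket (p |: T).

Lemma ket_creation T p : ket T *m creation p =
  if p \in T then 0 else (-1) ^+ #|[set q in T | (p < q)%N]| *: ket (p |: T).
Proof. by rewrite -rowE rowK enum_rankK. Qed.

Lemma fock_eqP (X Y : 'M[S]_N) : (forall T, ket T *m X = ket T *m Y) -> X = Y.
Proof.
by move=> XY; apply/row_matrixP => i; rewrite !rowE -(enum_valK i); apply: XY.
Qed.

Lemma ket_scalar T c : ket T *m c%:M = c *: ket T.
Proof.
rewrite -rowE; apply/rowP => j; rewrite !mxE eqxx.
by case: eqVneq; rewrite (mulr1, mulr0).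
Qed.

(** The coefficients of [creation p] are 0, 1 and -1, hence central. *)
Lemma creation_scalar p c : creation p * c%:M = c%:M * creation p.
Proof.
apply: fock_eqP => T; rewrite -[creation p * _]/(_ *m _) -[_ * creation p]/(_ *m _).
rewrite !mulmxA ket_scalar -scalemxAl ket_creation.
case: ifP => _; first by rewrite mul0mx scaler0.
by rewrite -scalemxAl ket_scalar !scalerA commr_sign.
Qed.

Lemma creation_sq p : creation p * creation p = 0.
Proof.
apply: fock_eqP => T; rewrite -[creation p * _]/(_ *m _) mulmxA mulmx0 ket_creation.
case: ifP => _; first by rewrite mul0mx.
by rewrite -scalemxAl ket_creation setU11 scaler0.
Qed.

(** For p < q, creating [q] first adds one element above [p] to the set seen by
    [creation p], while creating [p] first does not change what [q] sees. *)
Lemma creation_anticomm p q : creation p * creation q = - (creation q * creation p).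
Proof.
have [->|pq] := eqVneq p q; first by rewrite creation_sq oppr0.
wlog lt_pq : p q pq / (p < q)%N.
  move=> H; have [?|qp] := ltnP p q; first exact: H.
  by rewrite (H q p) ?opprK // 1?eq_sym // ltn_neqAle qp andbT eq_sym.
apply: fock_eqP => T; rewrite mulmxN.
rewrite -[creation p * _]/(_ *m _) -[creation q * _]/(_ *m _) !mulmxA !ket_creation.
have [pT|pT] := boolP (p \in T); have [qT|qT] := boolP (q \in T);
  rewrite ?mul0mx -?scalemxAl ?ket_creation ?inE ?pT ?qT ?orbT ?scaler0 ?oppr0 //.
rewrite (negPf pq) eq_sym (negPf pq) (negPf pT) (negPf qT) /= !scalerA (setUCA [set q]).
have ->: [set k in p |: T | (q < k)%N] = [set k in T | (q < k)%N].
  apply/setP => k; rewrite !inE; case: eqVneq => // ->.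
  by rewrite (negPf pT) ltnNge (ltnW lt_pq).
have ->: [set k in q |: T | (p < k)%N] = q |: [set k in T | (p < k)%N].
  by apply/setP => k; rewrite !inE; case: eqVneq => // ->.
rewrite cardsU1 !inE (negPf qT) /= exprS mulN1r mulrN scaleNr opprK.
by rewrite -!exprD addnC.
Qed.

Lemma ket_prod_creation (T : {set 'I_r}) (s : seq 'I_r) :
    sorted (fun p q : 'I_r => p < q)%N s ->
    (forall p q, p \in T -> q \in s -> (p < q)%N) ->
  ket T *m (\prod_(p <- s) creation p) = ket (T :|: [set p in s]).
Proof.
elim: s T => [|p s IH] T.
  rewrite big_nil mulmx1 => _ _; congr ket; apply/setP => k.
  by rewrite !inE orbF.
move=> /= srt Ts; rewrite big_cons -[creation p * _]/(_ *m _) mulmxA ket_creation.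
have ltps q : q \in s -> (p < q)%N.
  by apply/allP: q; apply: order_path_min srt => ? ? ?; apply: ltn_trans.
rewrite ifN; last by apply/negP => /Ts/(_ (mem_head _ _)); rewrite ltnn.
rewrite (_ : [set q in T | (p < q)%N] = set0) ?cards0 ?scale1r; last first.
  apply/setP => q; rewrite !inE; apply/negP => /andP[/Ts/(_ (mem_head _ _))].
  by move=> /ltnW; rewrite leqNgt => /negP.
rewrite IH.
- by congr ket; apply/setP => k; rewrite !inE orbCA orbA.
- exact: path_sorted srt.
- move=> q t; rewrite !inE => /orP[/eqP->|qT] ts; first exact: ltps.
  by apply: Ts; rewrite ?inE ?ts ?orbT.
Qed.

Definition top_form : 'M[S]_N := \prod_p creation p.

Lemma ket_top_form : ket set0 *m top_form = ket setT.
Proof.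
rewrite /top_form prod_enum ket_prod_creation.
- by congr ket; apply/setP => k; rewrite !inE mem_enum.
- by have := iota_ltn_sorted 0 r; rewrite -val_enum_ord sorted_map.
- by move=> p q; rewrite inE.
Qed.

Lemma scalar_top_form_inj c d : c%:M * top_form = d%:M * top_form -> c = d.
Proof.
move=> /(congr1 (fun X => ket set0 *m X)).
rewrite -[c%:M * _]/(_ *m _) -[d%:M * _]/(_ *m _) !mulmxA !ket_scalar -!scalemxAl.
rewrite ket_top_form => /rowP/(_ (enum_rank setT)).
by rewrite !mxE !eqxx !mulr1.
Qed.

End Fock.

(** * Sums over injective maps *)
Section SumInjective.
Variables (V : nmodType).

Lemma sum_injective_perm (T : finType) (G : {ffun T -> T} -> V) :
    (forall f : {ffun T -> T}, ~~ injectiveb f -> G f = 0) ->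
  \sum_f G f = \sum_(s : {perm T}) G [ffun q => s q].
Proof.
move=> G0; rewrite (bigID (fun f : {ffun T -> T} => injectiveb f)) /=.
rewrite [X in _ + X]big1 // addr0 (reindex (fun s : {perm T} => val s)) /=.
  apply: eq_big => [s|s _]; first exact: (valP s).
  by congr G; apply/ffunP => q; rewrite ffunE pvalE.
exists (insubd (1%g : {perm T})) => [s _|f]; first exact: valKd.
by rewrite inE => ?; apply: insubdK.
Qed.

(** An injective map f from [r] to [m] is the same as its image L together with
    the permutation comparing f with a fixed enumeration [e L] of L.  The map
    from the pairs (L, s) to the injections is injective, and C(m, r) r! is the
    number of injections.  The enumeration is left arbitrary because both the
    increasing and the decreasing one are needed. *)
Lemma sum_injective_rsubset m r (e : rsubset m r -> 'I_r -> 'I_m)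
    (G : {ffun 'I_r -> 'I_m} -> V) :
    (forall L, injective (e L)) -> (forall L q, e L q \in val L) ->
    (forall f : {ffun 'I_r -> 'I_m}, ~~ injectiveb f -> G f = 0) ->
  \sum_f G f = \sum_L \sum_(s : 'S_r) G [ffun q => e L (s q)].
Proof.
move=> e_inj eL G0; rewrite pair_big /=.
rewrite (bigID (fun f : {ffun 'I_r -> 'I_m} => injectiveb f)) /=.
rewrite [X in _ + X]big1 // addr0.
pose h (x : rsubset m r * 'S_r) := [ffun q => e x.1 (x.2 q)].
have imE x : [set h x q | q : 'I_r] = val x.1.
  apply/eqP; rewrite eqEcard (eqP (valP x.1)) card_imset ?card_ord ?leqnn.
    by rewrite andbT; apply/subsetP => _ /imsetP[q _ ->]; rewrite ffunE.
  by move=> q q'; rewrite !ffunE => /e_inj/perm_inj.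
have h_inj : injective h.
  move=> [L s] [L' s'] E; have /val_inj EL : val L = val L'.
    by rewrite -(imE (L, s)) E imE.
  move: E; rewrite EL => /ffunP E; congr (_, _); apply/permP => q.
  by apply: (e_inj L'); have := E q; rewrite !ffunE.
have im_h : [set h x | x : rsubset m r * 'S_r] = [set f : {ffun 'I_r -> 'I_m} | injectiveb f].
  apply/eqP; rewrite eqEcard; apply/andP; split.
    apply/subsetP => _ /imsetP[[L s] _ ->]; rewrite inE; apply/injectiveP.
    by move=> q q'; rewrite !ffunE => /e_inj/perm_inj.
  rewrite card_inj_ffuns card_imset // card_prod card_Sn !card_ord.
  rewrite card_sig -bin_ffact leq_mul2r; apply/orP; right.
  by have := card_draws 'I_m r; rewrite card_ord cardsE => ->.
rewrite (eq_bigl [in [set f : {ffun 'I_r -> 'I_m} | injectiveb f]]) => [|f]; last by rewrite inE.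
rewrite -im_h big_imset /=; last by move=> x y _ _; apply: h_inj.
by apply: eq_bigl => x; rewrite inE.
Qed.

Lemma sum_ffun_recl r m (G : 'I_m -> {ffun 'I_r -> 'I_m} -> V) :
  \sum_(f : {ffun 'I_r.+1 -> 'I_m}) G (f ord0) [ffun q => f (lift ord0 q)] =
  \sum_i \sum_(f : {ffun 'I_r -> 'I_m}) G i f.
Proof.
rewrite pair_big /= (reindex (fun x : 'I_m * {ffun 'I_r -> 'I_m} =>
  [ffun q => if unlift ord0 q is Some q' then x.2 q' else x.1])) /=.
  apply: eq_bigr => -[i f] _ /=; rewrite ffunE unlift_none; congr G.
  by apply/ffunP => q; rewrite !ffunE liftK.
exists (fun f => (f ord0, [ffun q => f (lift ord0 q)])) => [[i f]|f] _ /=.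
  by rewrite ffunE unlift_none; congr (_, _); apply/ffunP => q; rewrite !ffunE liftK.
by apply/ffunP => q; rewrite !ffunE; case: unliftP => [q'|] ->; rewrite ?ffunE.
Qed.
End SumInjective.

(** * Moving the b-factors to the left *)
Section Capelli.
Variables (Lam : pzRingType) (m : nat) (J : Type).
Variables (a : 'I_m -> Lam) (b : 'I_m -> J -> Lam) (h : J -> Lam).
Hypothesis aa : forall f g, a f * a g = - (a g * a f).
Hypothesis ah : forall f j, h j * a f = - (a f * h j).
Hypothesis ab : forall f g j, a f * b g j = b g j * a f - (if f == g then h j else 0).

(** By induction on [s], adding a factor [a g] at the right end: exchanging it
    with [b f j] costs [- a g * prod * h j] for f = g only, and carrying [h j] to
    the left end and [a g] back to the right end takes [size s + 1] and [size s]
    sign changes, which leaves [+ h j * prod * a g]. *)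
Lemma capelli_contraction j (s : seq 'I_m) :
  \sum_f a f * (\prod_(g <- s) a g * b f j) =
  (\sum_f a f * b f j + h j *+ size s) * \prod_(g <- s) a g.
Proof.
elim/last_ind: s => [|s g IH].
  by rewrite big_nil mulr1 addr0; apply: eq_bigr => f _; rewrite mul1r.
rewrite size_rcons big_rcons /= mulrSr addrA mulrDl (mulrA (_ + _)) -IH.
have split_b f : a f * (\prod_(i <- s) a i * a g * b f j) =
    a f * (\prod_(i <- s) a i * b f j) * a g
    - (if f == g then a g * \prod_(i <- s) a i * h j else 0).
  rewrite -(mulrA (\prod_(i <- s) _)) ab mulrBr mulrBr !mulrA eq_sym.
  by case: eqVneq => [->|_] //; rewrite !(mulr0, mul0r).
rewrite (eq_bigr _ (fun f _ => split_b f)) big_split /= -big_distrl; congr (_ + _).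
rewrite sumrN -big_mkcond big_pred1_eq.
rewrite (anticomm_prod s (aa g)) -!mulrA.
rewrite (mulrA (h j)) (anticomm_prod s (ah^~ j)).
by rewrite -!mulrA ah !mulrN.
Qed.

(** The contraction is applied to the leftmost b-factor, summing over the value
    of f at the first index while its other values are kept fixed; at index q
    there remain r - q - 1 a-factors to cross (indices start at 0). *)
Lemma capelli_rearrangement r (j : 'I_r -> J) :
  \sum_(f : {ffun 'I_r -> 'I_m}) (\prod_q a (f q)) * (\prod_q b (f q) (j q)) =
  \prod_(q < r) (\sum_f a f * b f (j q) + h (j q) *+ (r - q.+1)).
Proof.
elim: r j => [|r IH] j.
  rewrite big_ord0 (eq_bigr (fun=> 1)) => [|f _]; last by rewrite !big_ord0 mulr1.
  by rewrite sumr_const card_ffun !card_ord.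
rewrite big_ord_recl subn1 /= -[X in _ = _ * X](IH (fun q => j (lift ord0 q))).
pose G i (f : {ffun 'I_r -> 'I_m}) := a i * (\prod_q a (f q) * b i (j ord0)) *
   \prod_q b (f q) (j (lift ord0 q)).
transitivity (\sum_i \sum_f G i f).
  rewrite -sum_ffun_recl; apply: eq_bigr => f _; rewrite !big_ord_recl /G !mulrA.
  by congr (_ * _ * _ * _); apply: eq_bigr => q _; rewrite ffunE.
rewrite exchange_big big_distrr; apply: eq_bigr => f _ /=.
rewrite -big_distrl /= mulrA; congr (_ * _).
rewrite prod_enum -(big_map f xpredT) capelli_contraction.
by rewrite size_map size_enum_ord.
Qed.
End Capelli.

(** * Determinants as coefficients *)
Definition coldet (S : pzRingType) r (M : 'I_r -> 'I_r -> S) : S :=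
  \sum_(s : 'S_r) (-1) ^+ s * \prod_q M (s q) q.

Definition rowdet (S : pzRingType) r (M : 'I_r -> 'I_r -> S) : S :=
  \sum_(s : 'S_r) (-1) ^+ s * \prod_q M q (s q).

Lemma prod_mul_commute (S : pzRingType) (I : Type) (s : seq I) (c e : I -> S) :
    (forall i j, e i * c j = c j * e i) ->
  \prod_(i <- s) (c i * e i) = \prod_(i <- s) c i * \prod_(i <- s) e i.
Proof.
move=> ec; elim: s => [|i s IH]; first by rewrite !big_nil mulr1.
have eC : GRing.comm (e i) (\prod_(j <- s) c j) by apply: commr_prod => j _; exact: ec.
by rewrite !big_cons IH !mulrA -(mulrA (c i)) eC !mulrA.
Qed.

Section Grassmann.
Variables (S : pzRingType) (r : nat).
Local Notation E := (@creation S r).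
Local Notation Lam := 'M[S]_#|{set 'I_r}|.

Definition form (u : 'I_r -> S) : Lam := \sum_p (u p)%:M * E p.

Lemma form_mul u v : form u * form v = \sum_p \sum_q (u p * v q)%:M * (E p * E q).
Proof.
rewrite /form big_distrl; apply: eq_bigr => p _; rewrite big_distrr.
apply: eq_bigr => q _ /=; rewrite rmorphM !mulrA; congr (_ * _).
by rewrite -!mulrA creation_scalar.
Qed.

(** The terms (p, q) and (q, p) cancel each other and the diagonal terms are
    zero; halving a sum of opposite terms would need 2 to be regular. *)
Lemma symmetric_form0 (c : 'I_r -> 'I_r -> S) : (forall p q, c p q = c q p) ->
  \sum_p \sum_q (c p q)%:M * (E p * E q) = 0.
Proof.
move=> csym; pose F p q : Lam := (c p q)%:M * (E p * E q).
have F0 p : F p p = 0 by rewrite /F creation_sq mulr0.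
have FN p q : F q p = - F p q by rewrite /F csym creation_anticomm mulrN.
transitivity (\sum_(p < r) \sum_(q < r | (p < q)%N) F p q +
    \sum_(p < r) \sum_(q < r | (q < p)%N) F p q).
  rewrite -big_split; apply: eq_bigr => p _ /=.
  rewrite (bigD1 p) //= -/(F p p) F0 add0r (bigID (fun q : 'I_r => (p < q)%N)) /=.
  by congr (_ + _); apply: eq_bigl => q; rewrite -val_eqE /=; case: ltngtP.
rewrite [X in _ + X](exchange_big_dep xpredT) //= -big_split big1 // => p _ /=.
by rewrite -big_split big1 // => q _; rewrite /= FN addNr.
Qed.

(** Among the maps f which arise from expanding the product, those that are not
    injective contribute a repeated E, and a permutation contributes its sign
    times the top form. *)
Lemma prod_form (M : 'I_r -> 'I_r -> S) :
  \prod_q form (M^~ q) = (coldet M)%:M * top_form S r.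
Proof.
rewrite bigA_distr_bigA.
have splitE (f : {ffun 'I_r -> 'I_r}) : \prod_q ((M (f q) q)%:M * E (f q)) =
    \prod_q (M (f q) q)%:M * \prod_q E (f q).
  by apply: prod_mul_commute => p q; apply: creation_scalar.
rewrite (eq_bigr _ (fun f _ => splitE f)).
rewrite sum_injective_perm => [|f /injectivePn[p [q pq fpq]]]; last first.
  by rewrite (alternating_repeat (@creation_sq S r) (@creation_anticomm S r) pq fpq) mulr0.
rewrite /coldet rmorph_sum big_distrl; apply: eq_bigr => s _ /=.
have /= := alternating_perm (@creation_anticomm S r) id s.
rewrite (eq_bigr (fun q => E ([ffun q => s q] q))) => [->|q _]; last by rewrite ffunE.
rewrite (eq_bigr (fun q => (M (s q) q)%:M)) => [|q _]; last by rewrite ffunE.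
by rewrite rmorphM rmorph_sign rmorph_prod mulrA commr_sign.
Qed.

End Grassmann.

(** * The Cauchy-Binet-Capelli identity over unital rings *)
Section CauchyBinetCapelli.
Variables (S : pzRingType) (m r : nat).

(** [a f p], [b f q] and [h p q] stand for a_(f, i_p), b_(f, j_q) and
    h_(i_p, j_q): the sets I and J only matter through the columns which they
    select. *)
Lemma cauchy_binet_capelli_col (a b : 'I_m -> 'I_r -> S) (h : 'I_r -> 'I_r -> S)
    (e : rsubset m r -> 'I_r -> 'I_m) :
    (forall L, injective (e L)) -> (forall L q, e L q \in val L) ->
    (forall f g p q, a f p * b g q - b g q * a f p = - (if f == g then h p q else 0)) ->
    (forall f g p q, a f p * a g q - a g q * a f p = a f q * a g p - a g p * a f q) ->
    (forall f p q, a f p * a f q = a f q * a f p) ->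
  \sum_L coldet (fun p q => a (e L q) p) * coldet (fun p q => b (e L p) q) =
  coldet (fun p q => \sum_f a f p * b f q + h p q *+ (r - q.+1)).
Proof.
move=> e_inj eL ab aa acomm; apply: scalar_top_form_inj.
pose A f := form (a f); pose B f q : 'M[S]_#|{set 'I_r}| := (b f q)%:M.
pose H q := form (h^~ q).
(* The last hypothesis says that [a f p * a f q] is symmetric in p and q. *)
have A_sq f : A f * A f = 0 by rewrite /A form_mul symmetric_form0.
have anti f u : (forall p q, a f p * u q - u q * a f p = a f q * u p - u p * a f q) ->
    A f * form u = - (form u * A f).
  move=> sym; apply/eqP; rewrite -addr_eq0 !form_mul; apply/eqP.
  rewrite [X in _ + X]exchange_big -big_split /=.
  rewrite -[RHS](symmetric_form0 (c := fun p q => a f p * u q - u q * a f p)) //.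
  apply: eq_bigr => p _; rewrite -big_split; apply: eq_bigr => q _ /=.
  by rewrite rmorphB mulrBl (creation_anticomm _ p q) !mulrN opprK.
have A_anti f g : A f * A g = - (A g * A f) by apply: anti.
have H_anti f q : H q * A f = - (A f * H q).
  rewrite anti ?opprK // => p p'.
  (* By the bracket of [a f i] with [b f j], [a f p * h p' q - h p' q * a f p] is
     a combination of products of [a f p], [a f p'] and [b f q], and it is
     symmetric in p and p' as soon as [a f p] and [a f p'] commute. *)
  have hE i j : h i j = b f j * a f i - a f i * b f j.
    by apply: oppr_inj; rewrite opprB ab eqxx.
  rewrite !hE !(mulrBr, mulrBl) !mulrA (acomm f p' p) -!(mulrA (b f q)) (acomm f p' p).
  by rewrite !opprB addrACA [RHS]addrACA; congr (_ + _); exact: addrC.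
have AB f g q : A f * B g q = B g q * A f - (if f == g then H q else 0).
  have -> : (if f == g then H q else 0) = form (fun p => if f == g then h p q else 0).
    case: eqVneq => // _; rewrite /form big1 // => p _; by rewrite rmorph0 mul0r.
  rewrite /A /B /form big_distrl big_distrr -sumrB; apply: eq_bigr => p _ /=.
  rewrite -mulrA creation_scalar !mulrA -!rmorphM -mulrBl -rmorphB; congr (_%:M * _).
  by rewrite -ab addrC subrK.
have scalar_top c : GRing.comm (c%:M) (top_form S r).
  by apply: commr_prod => p _; apply/esym/creation_scalar.
(* The permutation in [coldet b] is transferred to the alternating product of
   the A's, and L and the permutation are merged into one map f. *)
transitivity (\sum_(f : {ffun 'I_r -> 'I_m}) (\prod_q A (f q)) * (\prod_q B (f q) q)).
  rewrite (sum_injective_rsubset e_inj eL) => [|f /injectivePn[p [q pq fpq]]]; last first.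
    by rewrite (alternating_repeat A_sq A_anti pq fpq) mul0r.
  rewrite rmorph_sum big_distrl; apply: eq_bigr => L _ /=.
  rewrite rmorphM -mulrA scalar_top mulrA -prod_form.
  rewrite /coldet rmorph_sum big_distrr; apply: eq_bigr => s _ /=.
  rewrite rmorphM rmorph_sign rmorph_prod mulrA commr_sign.
  rewrite -(alternating_perm A_anti (e L)).
  by congr (_ * _); apply: eq_bigr => q _; rewrite ffunE.
rewrite (capelli_rearrangement A_anti H_anti AB) -prod_form.
apply: eq_bigr => q _; rewrite /form.
under [RHS]eq_bigr => p _ do rewrite rmorphD mulrDl rmorph_sum big_distrl /=.
rewrite big_split /= exchange_big; congr (_ + _).
  apply: eq_bigr => f _; rewrite /A /form big_distrl; apply: eq_bigr => p _ /=.
  by rewrite rmorphM -!mulrA creation_scalar.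
by rewrite /H /form -sumrMnl; apply: eq_bigr => p _; rewrite rmorphMn mulrnAl.
Qed.
End CauchyBinetCapelli.

Lemma rev_enum_ord r : rev (enum 'I_r) = [seq rev_ord q | q <- enum 'I_r].
Proof.
apply: (inj_map val_inj); rewrite map_rev val_enum_ord -map_comp.
rewrite (eq_map (g := (fun i => r - i.+1)%N \o val)) // map_comp val_enum_ord.
apply: (@eq_from_nth _ 0%N) => [|i]; rewrite size_rev ?size_map // size_iota => lt_ir.
rewrite nth_rev ?size_iota // (nth_map 0%N) ?size_iota // !nth_iota //.
by rewrite -subSn // subSS leq_subr.
Qed.

(** Passing to the opposite ring reverses the order of the factors.  This is
    compensated by reversing the indices, which conjugates the permutation and
    hence preserves its sign. *)
Lemma rowdet_converse (S : pzRingType) r (M : 'I_r -> 'I_r -> S) :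
  rowdet M = @coldet S^c r (fun p q => M (rev_ord q) (rev_ord p)).
Proof.
pose w : 'S_r := perm (@rev_ord_inj r).
have ww : (w * w = 1)%g by apply/permP => q; rewrite permM !permE rev_ordK.
pose conj s : 'S_r := (w * s * w)%g.
have conjK : involutive conj.
  by move=> s; rewrite /conj !mulgA ww mul1g -mulgA ww mulg1.
rewrite /coldet /rowdet (reindex_inj (inv_inj conjK)) /=; apply: eq_bigr => s _.
rewrite [in RHS]prod_enum rev_prodr rev_enum_ord big_map -[in RHS]prod_enum.
rewrite /conj !odd_permM addbAC addbb addFb.
rewrite (eq_bigr (fun q => M q (rev_ord (s (rev_ord q))))) => [|q _]; last first.
  by rewrite !permM !permE.
rewrite [in RHS](eq_bigr (fun q => M q (rev_ord (s (rev_ord q))))) => [|q _]; last first.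
  by rewrite rev_ordK.
case: (odd_perm s).
  by rewrite [RHS]mulrN1 mulN1r.
by rewrite [RHS]mulr1 mul1r.
Qed.

(** The column identity in the opposite ring, for the reversed [b] and [a] in
    the roles of [a] and [b].  Reversing the indices turns the correction
    factor r - q - 1 into q. *)
Lemma cauchy_binet_capelli_row (S : pzRingType) (m r : nat)
    (a b : 'I_m -> 'I_r -> S) (h : 'I_r -> 'I_r -> S)
    (e : rsubset m r -> 'I_r -> 'I_m) :
    (forall L, injective (e L)) -> (forall L q, e L q \in val L) ->
    (forall f g p q, a f p * b g q - b g q * a f p = - (if f == g then h p q else 0)) ->
    (forall f g p q, b f p * b g q - b g q * b f p = b f q * b g p - b g p * b f q) ->
    (forall f p q, b f p * b f q = b f q * b f p) ->
  \sum_L rowdet (fun p q => a (e L q) p) * rowdet (fun p q => b (e L p) q) =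
  rowdet (fun p q => \sum_f a f p * b f q + h p q *+ p).
Proof.
move=> e_inj eL ab bb bcomm.
rewrite rowdet_converse.
transitivity (\sum_L @coldet S^c r (fun p q => b (e L (rev_ord q)) (rev_ord p)) *
    @coldet S^c r (fun p q => a (e L (rev_ord p)) (rev_ord q)) : S^c).
  by apply: eq_bigr => L _; rewrite !rowdet_converse.
apply: (@cauchy_binet_capelli_col S^c m r (fun f p => b f (rev_ord p))
  (fun f q => a f (rev_ord q)) (fun p q => h (rev_ord q) (rev_ord p))
  (fun L q => e L (rev_ord q))).
- by move=> L q q' /e_inj/rev_ord_inj.
- by move=> L q; apply: eL.
- by move=> f g p q; have := ab g f (rev_ord q) (rev_ord p); rewrite eq_sym.
- by move=> f g p q; exact: (bb g f (rev_ord q) (rev_ord p)).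
- by move=> f p q; apply: bcomm.
Qed.

(** * Adjoining an identity *)
Section Unitization.
Variable R : rngType.
Implicit Types x y : R.

(** The one-sided multiplications are named so that the general lemmas on
    additive maps apply to them. *)
Definition rng_mull x y : R := (x * y)%g.
Definition rng_mulr y x : R := (x * y)%g.

Fact rng_mull_zmod_morphism x : zmod_morphism (rng_mull x).
Proof.
move=> y z; rewrite /rng_mull; apply: (addIr (x * z)%g).
by rewrite -rng_mulDr !subrK.
Qed.
HB.instance Definition _ x :=
  GRing.isZmodMorphism.Build R R (rng_mull x) (rng_mull_zmod_morphism x).

Fact rng_mulr_zmod_morphism y : zmod_morphism (rng_mulr y).
Proof.
move=> x z; rewrite /rng_mulr; apply: (addIr (z * y)%g).
by rewrite -rng_mulDl !subrK.
Qed.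
HB.instance Definition _ y :=
  GRing.isZmodMorphism.Build R R (rng_mulr y) (rng_mulr_zmod_morphism y).

Lemma rng_mulzr x y k : (x * (y *~ k))%g = (x * y)%g *~ k.
Proof. exact: (raddfMz (rng_mull x)). Qed.

Lemma rng_mulzl x y k : ((x *~ k) * y)%g = (x * y)%g *~ k.
Proof. exact: (raddfMz (rng_mulr y)). Qed.

(** The Dorroh extension: the pair (k, x) stands for k + x. *)
Definition unitization : Type := int * R.
HB.instance Definition _ := GRing.Zmodule.on unitization.

Definition unitization_one : unitization := (1, 0).
Definition unitization_mul (u v : unitization) : unitization :=
  (u.1 * v.1, u.2 *~ v.1 + v.2 *~ u.1 + (u.2 * v.2)%g).

Fact unitization_mulA : associative unitization_mul.
Proof.
move=> [i x] [j y] [k z]; congr (_, _) => /=; first exact: mulrA.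
rewrite !rng_mulDr !rng_mulDl !mulrzDl.
rewrite !rng_mulzr !rng_mulzl mulgA !mulrzA.
rewrite (mulrzAC i k) (mulrzAC i j).
by rewrite [LHS](AC (1 * 3 * 3) (1 * 2 * 5 * 3 * (6 * 4 * 7))) /=.
Qed.

Fact unitization_mul1 : left_id unitization_one unitization_mul.
Proof.
move=> [i x]; congr (_, _); rewrite /= ?mul1r //.
by rewrite mul0rz add0r -[X in _ + X]/(rng_mulr x 0) raddf0 addr0.
Qed.

Fact unitization_mulr1 : right_id unitization_one unitization_mul.
Proof.
move=> [i x]; congr (_, _); rewrite /= ?mulr1 //.
by rewrite mul0rz addr0 -[X in _ + X]/(rng_mull x 0) raddf0 addr0.
Qed.

Fact unitization_mulDl : left_distributive unitization_mul +%R.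
Proof.
move=> [i x] [j y] [k z]; congr (_, _) => /=; first exact: mulrDl.
by rewrite rng_mulDl mulrzDl mulrzDr (addrACA (x *~ k)) [LHS]addrACA.
Qed.

Fact unitization_mulDr : right_distributive unitization_mul +%R.
Proof.
move=> [i x] [j y] [k z]; congr (_, _) => /=; first exact: mulrDr.
by rewrite rng_mulDr mulrzDl mulrzDr (addrACA (x *~ j)) [LHS]addrACA.
Qed.

HB.instance Definition _ := GRing.Zmodule_isPzRing.Build unitization
  unitization_mulA unitization_mul1 unitization_mulr1 unitization_mulDl unitization_mulDr.

Definition to_unital x : unitization := (0, x).

Fact to_unital_zmod_morphism : zmod_morphism to_unital.
Proof. by move=> x y; congr (_, _); rewrite /= subr0. Qed.
HB.instance Definition _ :=
  GRing.isZmodMorphism.Build R unitization to_unital to_unital_zmod_morphism.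

Lemma to_unital_inj : injective to_unital.
Proof. by move=> x y []. Qed.

Lemma to_unitalM x y : to_unital (x * y)%g = to_unital x * to_unital y.
Proof. by congr (_, _); rewrite /= ?mulr0z ?add0r. Qed.

Lemma to_unital_mulseq s : s != [::] ->
  to_unital (mulseq s) = \prod_(x <- s) to_unital x.
Proof.
elim: s => // x [|y s] IH _; first by rewrite big_seq1.
by rewrite mulseq_cons // to_unitalM IH // [RHS]big_cons.
Qed.

Lemma to_unital_bracket x y :
  to_unital (bracket x y) = to_unital x * to_unital y - to_unital y * to_unital x.
Proof. by rewrite raddfB /= !to_unitalM. Qed.

Lemma to_unital_prod r (F : 'I_r -> R) : (0 < r)%N ->
  to_unital (mulseq [seq F q | q <- enum 'I_r]) = \prod_q to_unital (F q).
Proof.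
move=> r_gt0; rewrite to_unital_mulseq ?prod_enum ?big_map //.
by rewrite -size_eq0 size_map size_enum_ord -lt0n.
Qed.

Lemma to_unital_sign x (b : bool) : to_unital (x *~ (-1) ^+ b) = (-1) ^+ b * to_unital x.
Proof. by case: b; rewrite ?mulN1r ?mul1r ?mulrN1z ?mulr1z ?raddfN. Qed.

Lemma to_unital_col_det r (M : 'M[R]_r) : (0 < r)%N ->
  to_unital (col_det M) = coldet (fun p q => to_unital (M p q)).
Proof.
move=> r_gt0; rewrite raddf_sum; apply: eq_bigr => s _.
by rewrite /= to_unital_sign to_unital_prod.
Qed.

Lemma to_unital_row_det r (M : 'M[R]_r) : (0 < r)%N ->
  to_unital (row_det M) = rowdet (fun p q => to_unital (M p q)).
Proof.
move=> r_gt0; rewrite raddf_sum; apply: eq_bigr => s _.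
by rewrite /= to_unital_sign to_unital_prod.
Qed.

Lemma bracket_eq0 x y : bracket x y = 0 -> commute x y.
Proof. by move/eqP; rewrite subr_eq0 => /eqP. Qed.

End Unitization.

(** * The theorem *)
Lemma elt_inj n r (I : rsubset n r) : injective (elt I).
Proof. by move=> p q /enum_val_inj/cast_ord_inj. Qed.

Lemma eq_coldet (S : pzRingType) r (M N : 'I_r -> 'I_r -> S) :
  M =2 N -> coldet M = coldet N.
Proof.
by move=> MN; apply: eq_bigr => s _; congr (_ * _); apply: eq_bigr.
Qed.

Lemma eq_rowdet (S : pzRingType) r (M N : 'I_r -> 'I_r -> S) :
  M =2 N -> rowdet M = rowdet N.
Proof.
by move=> MN; apply: eq_bigr => s _; congr (_ * _); apply: eq_bigr.
Qed.

Theorem proposition1p2 (R : rngType) (m n r : nat)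
    (A B : 'M[R]_(m, n)) (h : 'M[R]_n)
    (hAB : forall (i k : 'I_m) (j l : 'I_n),
       bracket (A i j) (B k l) = - (if i == k then h j l else 0))
    (hr : (1 <= r <= n)%N) (I J : rsubset n r) :
  [/\ (* (a) *)
      col_pseudo_comm A ->
      \sum_(L : rsubset m r)
          (col_det (minormx A^T I L) * col_det (minormx B L J))%g
        = col_det (minormx (rng_mulmx A^T B) I J + Qcol h I J),
      (* (b) *)
      col_pseudo_comm B ->
      \sum_(L : rsubset m r)
          (row_det (minormx A^T I L) * row_det (minormx B L J))%g
        = row_det (minormx (rng_mulmx A^T B) I J + Qrow h I J)
    & (* (c) *)
      (forall (i k : 'I_m) (j l : 'I_n), j != l ->
         bracket (A i j) (A k l) = 0 /\ bracket (B i j) (B k l) = 0) ->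
      \sum_(L : rsubset m r)
          (rng_det (minormx A^T I L) * rng_det (minormx B L J))%g
        = col_det (minormx (rng_mulmx A^T B) I J + Qcol h I J) /\
      col_det (minormx (rng_mulmx A^T B) I J + Qcol h I J)
        = row_det (minormx (rng_mulmx A^T B) I J + Qrow h I J) ].
Proof.
have /andP[r_gt0 _] := hr.
pose iota := @to_unital R.
pose a f p := iota (A f (elt I p)); pose b f q := iota (B f (elt J q)).
pose eta p q := iota (h (elt I p) (elt J q)).
have ab f g p q : a f p * b g q - b g q * a f p = - (if f == g then eta p q else 0).
  by rewrite -to_unital_bracket hAB raddfN; case: eqP.
(* The entries of the matrices on the right, with the multiple of h left open so
   as to serve for both Qcol and Qrow. *)
have ent p q k : iota (minormx (rng_mulmx A^T B) I J p q + h (elt I p) (elt J q) *+ k)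
    = \sum_f a f p * b f q + eta p q *+ k.
  rewrite /iota raddfD raddfMn /= !mxE raddf_sum; congr (_ + _).
  by apply: eq_bigr => f _; rewrite mxE; apply: to_unitalM.
have colP : col_pseudo_comm A ->
    \sum_(L : rsubset m r) (col_det (minormx A^T I L) * col_det (minormx B L J))%g
    = col_det (minormx (rng_mulmx A^T B) I J + Qcol h I J).
  move=> [pcA cA]; apply: to_unital_inj; rewrite raddf_sum to_unital_col_det //.
  transitivity (coldet (fun p q => \sum_f a f p * b f q + eta p q *+ (r - q.+1))).
    rewrite -(cauchy_binet_capelli_col (@elt_inj m r) (@mem_elt m r) ab).
    - apply: eq_bigr => L _; rewrite /= to_unitalM !to_unital_col_det //.
      by congr (_ * _); apply: eq_coldet => p q; rewrite !mxE.
    - by move=> f g p q; rewrite -!to_unital_bracket pcA.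
    - by move=> f p q; rewrite -!to_unitalM (bracket_eq0 (cA _ _ _)).
  by apply: eq_coldet => p q; rewrite -ent [in RHS]mxE; congr (iota (_ + _)); rewrite mxE.
have rowP : col_pseudo_comm B ->
    \sum_(L : rsubset m r) (row_det (minormx A^T I L) * row_det (minormx B L J))%g
    = row_det (minormx (rng_mulmx A^T B) I J + Qrow h I J).
  move=> [pcB cB]; apply: to_unital_inj; rewrite raddf_sum to_unital_row_det //.
  transitivity (rowdet (fun p q => \sum_f a f p * b f q + eta p q *+ p)).
    rewrite -(cauchy_binet_capelli_row (@elt_inj m r) (@mem_elt m r) ab).
    - apply: eq_bigr => L _; rewrite /= to_unitalM !to_unital_row_det //.
      by congr (_ * _); apply: eq_rowdet => p q; rewrite !mxE.
    - by move=> f g p q; rewrite -!to_unital_bracket pcB.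
    - by move=> f p q; rewrite -!to_unitalM (bracket_eq0 (cB _ _ _)).
  by apply: eq_rowdet => p q; rewrite -ent [in RHS]mxE; congr (iota (_ + _)); rewrite mxE.
split=> // comm0.
have pc (M : 'M[R]_(m, n)) : (forall i k j l, j != l -> bracket (M i j) (M k l) = 0) ->
    col_pseudo_comm M.
  move=> M0; split=> [i j k l|i j l].
    by have [->//|jl] := eqVneq j l; rewrite !M0 // eq_sym.
  have [->|jl] := eqVneq j l; [exact: subrr | exact: M0].
have A0 i k j l : j != l -> bracket (A i j) (A k l) = 0 by move=> /(comm0 i k)[].
have B0 i k j l : j != l -> bracket (B i j) (B k l) = 0 by move=> /(comm0 i k)[].
rewrite -rowP ?colP; [|exact: pc|exact: pc]; split=> //.
rewrite -colP; last exact: pc.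
apply: eq_bigr => L _; congr (_ * _)%g; apply/esym/row_det_comm => p q p' q' pp' qq';
  rewrite !mxE; apply: bracket_eq0; [apply: A0|apply: B0].
  by rewrite (inj_eq (@elt_inj _ _ _)).
by rewrite (inj_eq (@elt_inj _ _ _)).
Qed.
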